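(* Let $\{(X_i,Y_i)\}_{i\ge 1}$ be a stationary ergodic sequence of random vectors with values in $\mathbb{R}^d\times\mathbb{R}$ such that $E|Y_1|<\infty$; let $(X,Y)$ have the common distribution of the $(X_i,Y_i)$ and let $\mu$ be the distribution of $X$. Let $L>0$ and let $N_n$ be a non-decreasing sequence of positive integers with $N_n\to\infty$. With the kernel $K$, the set $S$, $m^*_L$ and $\hat m^*_{n,L}$ as in the context, the following hold. (a) Almost surely, for all $x\in S$ simultaneously, $\hat m^*_{n,L}(x)\to m^*_L(x)$. (b) If $S$ is a bounded subset of $\mathbb{R}^d$, then almost surely $\sup_{x\in S}|\hat m^*_{n,L}(x)-m^*_L(x)|\to0$. (c) If either (i) $|Y|\le D<\infty$ almost surely for some constant $D$ (which need not be known), or (ii) $\mu$ has bounded support, then almost surely $\int(\hat m^*_{n,L}(x)-m^*_L(x))^2\mu(dx)\to0$.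
   Context: $K:\mathbb{R}^d\to[0,\infty)$ is a continuous kernel satisfying $b\,1_{\{x\in S_{0,r}\}}\le K(x)\le 1_{\{x\in S_{0,1}\}}$ for some constants $0<b\le1$ and $0<r<1$, where $S_{z,\rho}$ denotes the closed Euclidean ball of center $z$ and radius $\rho$. Let $h_k=2^{-k-2}$. The support is $S=\{x\in\mathbb{R}^d:\mu(S_{x,1/k})>0\text{ for all }k\ge1\}$. For $x\in S$, $M^*_k(x)=\frac{E(YK((X-x)/h_k))}{E(K((X-x)/h_k))}$; for $k\ge2$, $\Delta^*_{k,L}(x)=\mathrm{sign}(M^*_k(x)-M^*_{k-1}(x))\min(|M^*_k(x)-M^*_{k-1}(x)|,L2^{-k})$; and $m^*_L(x)=M^*_1(x)+\sum_{k=2}^\infty\Delta^*_{k,L}(x)$. Estimator: $\hat M^*_{k,n}(x)=\frac{\sum_{j=1}^nY_jK((X_j-x)/h_k)}{\sum_{j=1}^nK((X_j-x)/h_k)}$ with the convention $0/0=0$; for $k\ge2$, $\hat\Delta^*_{k,n,L}(x)=\mathrm{sign}(\hat M^*_{k,n}(x)-\hat M^*_{k-1,n}(x))\min(|\hat M^*_{k,n}(x)-\hat M^*_{k-1,n}(x)|,L2^{-k})$; and $\hat m^*_{n,L}(x)=\hat M^*_{1,n}(x)+\sum_{k=2}^{N_n}\hat\Delta^*_{k,n,L}(x)$. *)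

(* Defs.v *)
From HB Require Import structures.
From mathcomp Require Import all_boot all_order all_algebra.
From mathcomp Require Import all_classical all_reals all_analysis.
Set Implicit Arguments. Unset Strict Implicit. Unset Printing Implicit Defensive.
Import Order.TTheory GRing.Theory Num.Theory.
Import numFieldNormedType.Exports.
Local Open Scope classical_set_scope.
Local Open Scope ring_scope.

Section Defs.
Variables (R : realType) (d : nat).

Definition state := ('rV[R]_d * R)%type.

Definition enorm (x : 'rV[R]_d) : R := Num.sqrt (\sum_(j < d) (x ord0 j) ^+ 2).
Definition cball (z : 'rV[R]_d) (rho : R) : set 'rV[R]_d :=
  [set x | enorm (x - z) <= rho].

(* Generators of the product sigma-algebra on sequences (nat -> R^d x R):
   cylinders given by a Borel condition on one real coordinate of one term. *)
Definition seq_cyl : set (set (nat -> state)) :=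
  [set C | exists k : nat,
     (exists (j : 'I_d) (A : set R), measurable A /\
        C = [set z : nat -> state | A ((z k).1 ord0 j)]) \/
     (exists A : set R, measurable A /\ C = [set z : nat -> state | A (z k).2])].

Definition seq_measurable (B : set (nat -> state)) : Prop := <<s seq_cyl >> B.

Definition shift (z : nat -> state) : nat -> state := fun k => z k.+1.

Context {dT : measure_display} {T : measurableType dT}.

Definition proc (X : nat -> T -> 'rV[R]_d) (Y : nat -> T -> R) : T -> nat -> state :=
  fun w k => (X k w, Y k w).

Definition stationary (P : probability T R) X Y : Prop :=
  forall B, seq_measurable B ->
    P (proc X Y @^-1` B) = P ((shift \o proc X Y) @^-1` B).

Definition ergodic (P : probability T R) X Y : Prop :=
  forall B, seq_measurable B -> shift @^-1` B = B ->
    P (proc X Y @^-1` B) = 0%E \/ P (proc X Y @^-1` B) = 1%E.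

Definition hk (k : nat) : R := ((2 : R) ^+ k.+2)^-1.

Definition supp (P : probability T R) (X0 : T -> 'rV[R]_d) : set 'rV[R]_d :=
  [set x | forall k : nat, (0 < k)%N ->
     (0 < P [set w | cball x (k%:R^-1) (X0 w)])%E].

Variable (K : 'rV[R]_d -> R).

Definition Kh (k : nat) (u x : 'rV[R]_d) : R := K ((hk k)^-1 *: (u - x)).

Definition Mstar (P : probability T R) (X0 : T -> 'rV[R]_d) (Y0 : T -> R)
    (k : nat) (x : 'rV[R]_d) : R :=
  fine (\int[P]_w (Y0 w * Kh k (X0 w) x)%:E) /
  fine (\int[P]_w (Kh k (X0 w) x)%:E).

Definition trunc (L : R) (k : nat) (a b : R) : R :=
  Num.sg (a - b) * Num.min `|a - b| (L * ((2 : R) ^+ k)^-1).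

Definition mstar P X0 Y0 (L : R) (x : 'rV[R]_d) : R :=
  Mstar P X0 Y0 1 x +
  limn (fun n => \sum_(2 <= k < n)
    trunc L k (Mstar P X0 Y0 k x) (Mstar P X0 Y0 k.-1 x)).

(* Estimator from the sample (X_0,Y_0),...,(X_{n-1},Y_{n-1}); 0/0 = 0 holds
   in MathComp since x / 0 = 0. *)
Definition Mhat (X : nat -> T -> 'rV[R]_d) (Y : nat -> T -> R) (n k : nat)
    (w : T) (x : 'rV[R]_d) : R :=
  (\sum_(j < n) Y j w * Kh k (X j w) x) / (\sum_(j < n) Kh k (X j w) x).

Definition mhat X Y (N : nat -> nat) (L : R) (n : nat) (w : T) (x : 'rV[R]_d) : R :=
  Mhat X Y n 1 w x +
  \sum_(2 <= k < (N n).+1) trunc L k (Mhat X Y n k w x) (Mhat X Y n k.-1 w x).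

End Defs.

(* Main.v *)
Require Import Defs.
From HB Require Import structures.
From mathcomp Require Import all_boot all_order all_algebra lra ring.
From mathcomp Require Import all_classical all_reals all_analysis measurable_realfun.
Import Order.TTheory GRing.Theory Num.Theory.
Import numFieldNormedType.Exports.
Local Open Scope classical_set_scope.
Local Open Scope ring_scope.
Set Implicit Arguments.
Unset Strict Implicit.
Unset Printing Implicit Defensive.

(** By Birkhoff's theorem, almost surely the averages of [Y_j K((X_j - q)/h_k)],
    of [K((X_j - q)/h_k)] and of [|Y_j|] converge for all [k] and all rational
    [q]. The kernel is uniformly continuous and the averages of [|Y_j|] are
    bounded, so the first two families are equicontinuous in the base point and
    converge jointly as [(n, x') -> (oo, x)]. On the support the limit of the
    denominators is positive, hence the ratios converge jointly too. The
    [k]-th term of the truncated series is at most [L 2^-k] whatever its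
    arguments, so joint convergence passes to [mhat]. Restricting to [x' = x]
    gives (a), compactness of a bounded support gives (b), and dominated
    convergence, with [X_0] almost surely in the support, gives (c). *)

(** * The pointwise ergodic theorem *)

Lemma exists_invSn_lt (R : realType) (e : R) : 0 < e ->
  exists k : nat, k.+1%:R^-1 < e.
Proof.
move=> e0; exists (Num.trunc e^-1); rewrite invf_plt ?posrE//.
exact: truncnS_gt.
Qed.

Section birkhoff.
Context (R : realType) (dT : measure_display) (T : measurableType dT).
Context (Q : probability T R) (theta : T -> T).
Context (mtheta : measurable_fun setT theta).
Context (inv : forall A, measurable A -> Q (theta @^-1` A) = Q A).
Context (erg : forall A, measurable A -> theta @^-1` A = A ->
  Q A = 0%E \/ Q A = 1%E).

Local Lemma integral_comp_ge0 (f : T -> \bar R) : measurable_fun setT f ->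
  (forall z, 0 <= f z)%E -> (\int[Q]_z f (theta z) = \int[Q]_z f z)%E.
Proof.
move=> mf f0.
have := ge0_integral_pushforward mtheta Q measurableT mf.
rewrite preimage_setT => <-; last by move=> z _; exact: f0.
by apply: eq_measure_integral => A mA _; exact: inv.
Qed.

Local Lemma integrable_comp (f : T -> R) : Q.-integrable setT (EFin \o f) ->
  Q.-integrable setT (EFin \o (f \o theta)).
Proof.
move=> /integrableP[mf intf]; apply/integrableP; split.
  by apply/measurable_EFinP/measurableT_comp => //; exact/measurable_EFinP.
rewrite (integral_comp_ge0 (f := fun z => `|(f z)%:E|%E))//.
exact: measurableT_comp.
Qed.

(* [max_sum g n] is the maximum of 0 and of the first [n] ergodic sums of [g];
   unfolding from the left makes its relation with [theta] definitional. *)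
Fixpoint max_sum (g : T -> R) (n : nat) (z : T) : R :=
  if n is m.+1 then Num.max 0 (g z + max_sum g m (theta z)) else 0.

Local Lemma max_sum_ge0 g n z : 0 <= max_sum g n z.
Proof. by case: n => //= n; rewrite le_max lexx. Qed.

Local Lemma max_sumS g n z : max_sum g n z <= max_sum g n.+1 z.
Proof.
elim: n z => [|n IH] z; first exact: max_sum_ge0.
rewrite /= ge_max le_max lexx /= le_max; apply/orP; right.
by rewrite lerD2l IH.
Qed.

Local Lemma max_sum_homo g z : {homo (max_sum g)^~ z : m n / (m <= n)%N >-> m <= n}.
Proof. by apply: homo_leq => [x|y x w|n]; [|exact: le_trans|exact: max_sumS]. Qed.

Local Lemma sum_le_max_sum g n z :
  \sum_(j < n) g (iter j theta z) <= max_sum g n z.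
Proof.
elim: n z => [|n IH] z; first by rewrite big_ord0.
rewrite big_ord_recl /= le_max; apply/orP; right; rewrite lerD2l.
apply: le_trans (IH (theta z)).
by apply: ler_sum => i _; rewrite -iterSr.
Qed.

Local Lemma measurable_max_sum g n : measurable_fun setT g ->
  measurable_fun setT (max_sum g n).
Proof.
move=> mg; elim: n => [|n IH] /=; first exact: measurable_cst.
apply: measurable_maxr; first exact: measurable_cst.
by apply: measurable_funD => //; exact: measurableT_comp.
Qed.

Local Lemma integrable_max_sum g n : Q.-integrable setT (EFin \o g) ->
  Q.-integrable setT (EFin \o max_sum g n).
Proof.
move=> ig; have mg : measurable_fun setT g.
  by apply/measurable_EFinP; case/integrableP: ig.
elim: n => [|n IH].
  exact: finite_measure_integrable_cst.
have i1 : Q.-integrable setT (EFin \o (g \+ (max_sum g n \o theta))).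
  rewrite (_ : _ \o _ = (EFin \o g) \+ (EFin \o (max_sum g n \o theta)))%E//.
  by apply: integrableD => //; exact: integrable_comp.
apply: le_integrable i1 => //.
  by apply/measurable_EFinP; exact: measurable_max_sum.
move=> z _ /=; rewrite lee_fin ger0_norm ?le_max ?lexx//.
by rewrite ge_max normr_ge0 ler_norm.
Qed.

(* [max_sum g n.+1 - max_sum g n \o theta = max (- max_sum g n \o theta) g] has a
   nonnegative integral by invariance, and decreases to [g] where [max_sum g] is
   unbounded; if the latter happened almost surely, [g] would have a nonnegative
   integral. *)
Local Lemma max_sum_unbounded_null g : Q.-integrable setT (EFin \o g) ->
  (\int[Q]_z (g z)%:E < 0)%E ->
  {ae Q, forall z, exists C, forall n, max_sum g n z <= C}.
Proof.
move=> ig g0; have mg : measurable_fun setT g.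
  by apply/measurable_EFinP; case/integrableP: ig.
pose B := \bigcap_(c : nat) \bigcup_(n : nat) [set z | c%:R < max_sum g n z].
have mB : measurable B.
  apply: bigcapT_measurable => c; apply: bigcupT_measurable => n.
  rewrite -[X in measurable X]setTI; have /= := measurable_max_sum n mg.
  by move=> /(_ measurableT _ (measurable_itv `]c%:R, +oo[)); rewrite set_itvE.
(* A positive maximal sum at [z] is [g z] plus a maximal sum at [theta z], so the maximal sums at
   the two points are unbounded together. *)
have BS : theta @^-1` B = B.
  apply/seteqP; split=> z Bz c _ /=.
    have [k kP] : exists k : nat, c%:R - g z <= k%:R.
      by exists (Num.trunc (c%:R - g z)).+1; apply/ltW/truncnS_gt.
    have [n _ /= nk] := Bz k Logic.I.
    exists n.+1 => //=; rewrite lt_max; apply/orP; right.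
    by rewrite -ltrBlDl; exact: le_lt_trans nk.
  have [k kP] : exists k : nat, c%:R + g z <= k%:R.
    by exists (Num.trunc (c%:R + g z)).+1; apply/ltW/truncnS_gt.
  have [[|n] _ /=] := Bz k Logic.I; first by rewrite ltNge ler0n.
  rewrite lt_max ltNge ler0n /= => nk; exists n => //=.
  by rewrite -(ltrD2l (g z)) addrC; exact: le_lt_trans nk.
have [QB|QB] := erg mB BS.
  exists B; split => // z /= hz c _.
  apply: contrapT => hc; apply: hz; exists c%:R => n.
  by rewrite leNgt; apply/negP => cn; apply: hc; exists n.
exfalso.
have aeB : {ae Q, forall z, B z}.
  exists (~` B); split => //; first exact: measurableC.
  by rewrite probability_setC// QB subee.
pose h n z := max_sum g n.+1 z - max_sum g n (theta z).
have hE n z : h n z = Num.max (- max_sum g n (theta z)) (g z).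
  by rewrite /h /= addr_maxl add0r addrK.
have hint n : (0 <= \int[Q]_z (h n z)%:E)%E.
  have i1 := integrable_max_sum n ig.
  have i2 := integrable_comp i1.
  have i3 := integrable_max_sum n.+1 ig.
  have -> : (\int[Q]_z (h n z)%:E = \int[Q]_z (max_sum g n.+1 z)%:E -
      \int[Q]_z (max_sum g n (theta z))%:E)%E.
    by rewrite -integralB.
  rewrite (integral_comp_ge0 (f := EFin \o max_sum g n)); last first.
  - by move=> z; rewrite lee_fin max_sum_ge0.
  - by apply/measurable_EFinP; exact: measurable_max_sum.
  rewrite sube_ge0 ?integrable_fin_num//.
  apply: ge0_le_integral => //.
  - by move=> z _; rewrite lee_fin max_sum_ge0.
  - by apply/measurable_EFinP; exact: measurable_max_sum.
  - by apply/measurable_EFinP; exact: measurable_max_sum.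
  - by move=> z _; rewrite lee_fin max_sumS.
have mh n : measurable_fun setT (h n).
  apply: measurable_funB; first exact: measurable_max_sum.
  by apply: measurableT_comp => //; exact: measurable_max_sum.
have [] := @dominated_convergence _ _ _ Q setT measurableT
   (fun n z => (h n z)%:E) (fun z => (g z)%:E) (fun z => `|g z|%:E).
- by move=> n; apply/measurable_EFinP.
- by apply/measurable_EFinP.
(* By invariance of [B] the maximal sums at [theta z] are unbounded as well; once they exceed
   [- g z], [h n z] is equal to [g z]. *)
- apply: filterS aeB => z; rewrite -{1}BS => Bz _.
  have [k kP] : exists k : nat, - g z <= k%:R.
    by exists (Num.trunc (- g z)).+1; apply/ltW/truncnS_gt.
  have [n _ /= nk] := Bz k Logic.I.
  apply: (@cvg_trans _ ((fun=> (g z)%:E) @ \oo)); last exact: cvg_cst.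
  apply: near_eq_cvg; near=> m.
  rewrite hE; congr EFin; apply/esym/max_r.
  rewrite lerNl; apply: (le_trans kP); apply: (le_trans (ltW nk)).
  apply: max_sum_homo; near: m; exact: nbhs_infty_ge.
- by have := integrable_norm ig.
(* Maximal sums are nonnegative, so [h n z] lies between [g z] and [Num.max 0 (g z)]. *)
- apply/aeW => z n _ /=; rewrite lee_fin hE ler_norml.
  rewrite le_max ge_max; apply/and3P; split.
  + by apply/orP; right; rewrite lerNl -normrN ler_norm.
  + by rewrite (@le_trans _ _ 0)// oppr_le0 max_sum_ge0.
  + exact: ler_norm.
move=> _ _ hcvg; move: g0; rewrite ltNge => /negP; apply.
rewrite -(cvg_lim _ hcvg)//; apply: lime_ge; first by apply/cvg_ex; eexists; exact: hcvg.
by near=> n; exact: hint.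
Unshelve. all: by end_near. Qed.

(* Apply the previous lemma to [g] minus a constant just above its mean. *)
Local Lemma birkhoff_le (g : T -> R) : Q.-integrable setT (EFin \o g) ->
  {ae Q, forall z, forall e, 0 < e -> \forall n \near \oo,
    n%:R^-1 * \sum_(j < n) g (iter j theta z) <= fine (\int[Q]_z (g z)%:E) + e}.
Proof.
move=> ig; set c := fine _.
have cE : (\int[Q]_z (g z)%:E = c%:E)%E.
  by rewrite fineK//; exact: integrable_fin_num.
have : forall m : nat, {ae Q, forall z, exists C, forall n,
    max_sum (fun z => g z - (c + m.+1%:R^-1)) n z <= C}.
  move=> m; set a := c + _.
  have ia := finite_measure_integrable_cst Q a measurableT.
  apply: max_sum_unbounded_null.
    exact: (integrableB measurableT ig ia).
  rewrite [ltLHS](integralB measurableT ig ia) cE /=.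
  rewrite (integral_cst Q measurableT a%:E).
  rewrite [X in (_ * X)%E](@probability_setT _ _ _ Q) mule1 -EFinB lte_fin.
  by rewrite /a opprD addrA subrr add0r oppr_lt0 invr_gt0.
move=> /(@ae_foralln _ _ _ Q); apply: filterS => z hz e e0.
(* The error [e] is shared: [m.+1%:R^-1] uses less than one half, and [C / n] at most the other half
   for large [n]. *)
have [m me] := exists_invSn_lt (divr_gt0 e0 (ltr0Sn _ 1)).
have [C hC] := hz m.
near=> n.
have n0 : (0 < n%:R :> R) by rewrite ltr0n; near: n; exact: nbhs_infty_gt.
have : C <= e / 2 * n%:R.
  rewrite mulrC -ler_pdivrMr ?divr_gt0//; near: n; exact: nbhs_infty_ger.
move=> Cn; rewrite mulrC ler_pdivrMr//.
have := le_trans (sum_le_max_sum _ n z) (hC n).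
rewrite sumrB big_const_ord iter_addr addr0 lerBlDr.
move=> /le_trans; apply; rewrite -[X in _ + X]mulr_natr.
rewrite (le_trans (lerD Cn (lexx _)))// -mulrDl ler_wpM2r//.
by rewrite addrC -addrA lerD2l [leRHS]splitr lerD2r ltW.
Unshelve. all: by end_near. Qed.

(** The upper bound of [birkhoff_le] for [- g] is the matching lower bound for [g]. *)
Theorem birkhoff (g : T -> R) : Q.-integrable setT (EFin \o g) ->
  {ae Q, forall z, n%:R^-1 * \sum_(j < n) g (iter j theta z) @[n --> \oo] -->
    fine (\int[Q]_z (g z)%:E)}.
Proof.
move=> ig; have iNg : Q.-integrable setT (EFin \o (\- g)).
  by have := integrableN ig.
have gN : fine (\int[Q]_z (- g z)%:E) = - fine (\int[Q]_z (g z)%:E).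
  under eq_integral do rewrite EFinN.
  rewrite integralN ?fineN//.
  exact/integrable_add_def.
apply: filterS2 (birkhoff_le ig) (birkhoff_le iNg) => z h1 h2.
apply/cvgrPdist_le => e e0; near=> n.
rewrite distrC ler_distl; apply/andP; split; last by near: n; exact: h1.
rewrite lerBlDr -lerBlDl -opprB -lerN2 opprK.
have : n%:R^-1 * \sum_(j < n) (- g (iter j theta z)) <=
   - fine (\int[Q]_z (g z)%:E) + e.
  by rewrite -gN; near: n; exact: h2.
by rewrite sumrN mulrN; lra.
Unshelve. all: by end_near. Qed.

End birkhoff.

(** * Random vectors and the law of large numbers *)

(** Balls are those of the sup norm. The clause [0 < e] has content only for [d = 0], where the
    coordinates impose nothing. *)
Lemma ball_rVP (R : realType) (d : nat) (x y : 'rV[R]_d) (e : R) :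
  ball x e y <-> 0 < e /\ forall j, `|x ord0 j - y ord0 j| < e.
Proof.
split=> [[e0 h]|[e0 h]]; first by split=> // j; exact: h.
by split=> // i j; rewrite (ord1 i); exact: h.
Qed.

Lemma exists_rat_rV (R : realType) (d : nat) (x : 'rV[R]_d) (e : R) : 0 < e ->
  exists q : 'rV[rat]_d, ball x e (map_mx ratr q).
Proof.
move=> e0.
have h j : {q : rat | `|x ord0 j - ratr q| < e}.
  apply: cid; have /rat_in_itvoo[q] : x ord0 j - e < x ord0 j + e by lra.
  by rewrite in_itv/= => /andP[h1 h2]; exists q; rewrite distrC ltr_distl h1.
exists (\row_j sval (h j)); apply/ball_rVP; split=> // j.
by rewrite !mxE; exact: svalP (h j).
Qed.

Section measurable_vector.
Context (R : realType) (d : nat) (dT : measure_display).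
Context (T : measurableType dT) (X : T -> 'rV[R]_d).
Context (mX : forall j, measurable_fun setT (fun w => X w ord0 j)).

Lemma measurable_preimage_ball (x : 'rV[R]_d) (e : R) :
  measurable (X @^-1` ball x e).
Proof.
have [e0|e0] := ltP 0 e; last first.
  rewrite (_ : _ @^-1` _ = set0)//; apply/seteqP; split=> // w /= /ball_rVP[].
  by rewrite ltNge e0.
rewrite (_ : _ @^-1` _ = ~` \bigcup_j (fun w => X w ord0 j) @^-1` (~` ball (x ord0 j) e)).
  apply/measurableC/countable_bigcupT_measurable => // j.
  rewrite -[X in measurable X]setTI; apply: mX => //.
  by apply: measurableC; exact: measurable_ball.
apply/seteqP; split=> w /=.
  by move=> /ball_rVP[_ h] [j _]; apply; exact: h.
move=> h; apply/ball_rVP; split => // j; apply: contrapT => hj.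
by apply: h; exists j.
Qed.

(** Measurability is known for coordinates only, hence for sup-norm balls. An open set is the
    countable union of the balls it contains with rational center and radius [k.+1%:R^-1]; the other
    indices contribute [set0]. *)
Lemma measurable_preimage_open (U : set 'rV[R]_d) : open U ->
  measurable (X @^-1` U).
Proof.
move=> oU.
pose F (p : 'rV[rat]_d * nat) : set 'rV[R]_d := ball (map_mx ratr p.1 : 'rV[R]_d) p.2.+1%:R^-1.
have -> : X @^-1` U = \bigcup_p (if `[< F p `<=` U >] then X @^-1` (F p) else set0).
  apply/seteqP; split=> w /= => [Uw|[p _]]; last first.
    by case: asboolP => [FU Fw|_ []]; exact: FU.
  have /nbhs_ballP[e /= e0 eU] : nbhs (X w) U by exact: open_nbhs_nbhs.
  have [k ke] := exists_invSn_lt (divr_gt0 e0 (ltr0Sn _ 1)).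
  have k0 : 0 < k.+1%:R^-1 :> R by rewrite invr_gt0.
  have [q hq] := exists_rat_rV (X w) k0.
  exists (q, k) => //; case: asboolP => /= [_|[]]; first exact: ball_sym.
  move=> y qy; apply: eU; rewrite (splitr e).
  exact: (ball_triangle (le_ball (ltW ke) hq) (le_ball (ltW ke) qy)).
apply: countable_bigcupT_measurable => // p; case: asboolP => // _.
exact: measurable_preimage_ball.
Qed.

Lemma measurable_continuous_comp (g : 'rV[R]_d -> R) : continuous g ->
  measurable_fun setT (g \o X).
Proof.
move=> cg mT; apply: (measurability _ (RGenOInfty.measurableE R)) => //.
move=> _ [_ [x ->] <-]; rewrite setTI comp_preimage.
apply: measurable_preimage_open; apply: open_comp => // y _; exact: cg.
Qed.

End measurable_vector.

Section lln.
Context (R : realType) (d : nat).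
Local Notation seqT := (g_sigma_algebraType (@seq_cyl R d)).

Lemma measurable_seq_fst (k : nat) (j : 'I_d) :
  measurable_fun setT (fun z : seqT => (z k).1 ord0 j).
Proof.
move=> _ A mA; rewrite setTI; apply: sub_sigma_algebra.
by exists k; left; exists j, A.
Qed.

Lemma measurable_seq_snd (k : nat) : measurable_fun setT (fun z : seqT => (z k).2).
Proof.
move=> _ A mA; rewrite setTI; apply: sub_sigma_algebra.
by exists k; right; exists A.
Qed.

Lemma measurable_to_seq (dT : measure_display) (T : measurableType dT)
  (f : T -> seqT) :
  (forall k j, measurable_fun setT (fun w => (f w k).1 ord0 j)) ->
  (forall k, measurable_fun setT (fun w => (f w k).2)) ->
  measurable_fun setT f.
Proof.
move=> m1 m2; apply: (@measurability _ _ T seqT setT f (@seq_cyl R d) erefl).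
move=> _ [_ [k [[j [A [mA ->]]]|[A [mA ->]]]] <-].
  exact: m1.
exact: m2.
Qed.

Context (dT : measure_display) (T : measurableType dT) (P : probability T R).
Context (X : nat -> T -> 'rV[R]_d) (Y : nat -> T -> R).
Context (mX : forall i j, measurable_fun setT (fun w => X i w ord0 j)).
Context (mY : forall i, measurable_fun setT (Y i)).
Context (statP : stationary P X Y) (ergP : ergodic P X Y).

(** Birkhoff's theorem is applied on the sequence space, to the shift and the law [Q] of the
    process: stationarity and ergodicity of the process are exactly invariance and ergodicity of
    [Q]. The exceptional null set is then pulled back along the process. *)
Theorem lln (f : state R d -> R) :
  measurable_fun setT (fun z : seqT => f (z 0%N)) ->
  P.-integrable setT (fun w => (f (X 0%N w, Y 0%N w))%:E) ->
  {ae P, forall w, n%:R^-1 * \sum_(j < n) f (X j w, Y j w) @[n --> \oo] -->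
    fine (\int[P]_w (f (X 0%N w, Y 0%N w))%:E)}.
Proof.
move=> mf intf.
have mp : measurable_fun setT (proc X Y : T -> seqT).
  by apply: measurable_to_seq => k *; [exact: mX|exact: mY].
pose p : {mfun T >-> seqT} := HB.pack (proc X Y : T -> seqT)
  (isMeasurableFun.Build _ _ _ _ (proc X Y : T -> seqT) mp).
pose Q : probability seqT R := distribution P p.
have ms : measurable_fun setT (@Defs.shift R d : seqT -> seqT).
  by apply: measurable_to_seq => k *; [exact: measurable_seq_fst|exact: measurable_seq_snd].
have inv A : measurable A -> Q ((@Defs.shift R d : seqT -> seqT) @^-1` A) = Q A.
  by move=> mA; apply/esym; exact: statP.
have erg A : measurable A -> (@Defs.shift R d : seqT -> seqT) @^-1` A = A ->
  Q A = 0%E \/ Q A = 1%E by exact: ergP.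
have iQ : Q.-integrable setT (fun z : seqT => (f (z 0%N))%:E).
  by apply: integrable_pushforward => //; exact/measurable_EFinP.
have [B [mB QB hB]] := birkhoff ms inv erg iQ.
exists (p @^-1` B); split => //.
  by rewrite -[X in measurable X]setTI; exact: (@mp).
move=> w /= hw; apply: hB => /= h; apply: hw; move: h.
have -> : (\int[Q]_z (f (z 0%N))%:E = \int[P]_w (f (X 0%N w, Y 0%N w))%:E)%E.
  by rewrite integral_pushforward//; exact/measurable_EFinP.
have shiftE j (z : nat -> state R d) k : iter j (@Defs.shift R d) z k = z (k + j)%N.
  by elim: j k => [|j IH] k /=; rewrite ?addn0// /Defs.shift IH addSnnS.
by under eq_fun do under eq_bigr do rewrite shiftE add0n.
Qed.

End lln.

(** * Support and kernel *)

Lemma ae_forall_countable (R : realType) (dT : measure_display)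
  (T : measurableType dT) (mu : {measure set T -> \bar R}) (I : countType)
  (A : I -> T -> Prop) :
  (forall i, {ae mu, forall w, A i w}) -> {ae mu, forall w, forall i, A i w}.
Proof.
move=> h.
have : forall n, {ae mu, forall w, if unpickle n is Some i then A i w else True}.
  by move=> n; case: unpickle => [i|]; [exact: h|exact: aeW].
move=> /(@ae_foralln _ _ _ mu); apply: filterS => w hw i.
by have := hw (pickle i); rewrite pickleK.
Qed.

Section enorm.
Context (R : realType) (d : nat).
Implicit Types x y z : 'rV[R]_d.

Lemma coord_le_enorm x j : `|x ord0 j| <= enorm x.
Proof.
rewrite -sqrtr_sqr ler_sqrt ?sumr_ge0//.
  by rewrite (bigD1 j)//= lerDl sumr_ge0// => *; exact: sqr_ge0.
by move=> *; exact: sqr_ge0.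
Qed.

Lemma enorm_le x (e : R) : 0 <= e -> (forall j, `|x ord0 j| <= e) ->
  enorm x <= d%:R * e.
Proof.
move=> e0 h; rewrite -[leRHS]ger0_norm ?mulr_ge0// -sqrtr_sqr ler_sqrt ?sqr_ge0//.
apply: (@le_trans _ _ (\sum_(j < d) e ^+ 2)).
  by apply: ler_sum => j _; rewrite -real_normK ?num_real// lerXn2r ?nnegrE.
rewrite sumr_const card_ord exprMn -[leLHS]mulr_natl ler_wpM2r ?sqr_ge0//.
by rewrite -natrX ler_nat; case: (d) => // n; rewrite leq_pmulr.
Qed.

Lemma cball_sub_ball x (rho e : R) : rho < e -> cball x rho `<=` ball x e.
Proof.
move=> re y; rewrite /cball/= => h.
have h' j : `|x ord0 j - y ord0 j| <= rho.
  apply: le_trans h; have := coord_le_enorm (y - x) j.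
  by rewrite !mxE distrC.
apply/ball_rVP; split; last by move=> j; exact: le_lt_trans (h' j) re.
by apply: le_lt_trans re; apply: le_trans h; exact: sqrtr_ge0.
Qed.

(** The Euclidean norm is at most [d] times the sup norm; dividing by [d.+1] keeps the radius
    meaningful for [d = 0]. *)
Lemma ball_sub_cball x (rho : R) : 0 <= rho ->
  ball x (rho / d.+1%:R) `<=` cball x rho.
Proof.
move=> rho0 y /ball_rVP[_ h]; rewrite /cball/=.
apply: (@le_trans _ _ (d%:R * (rho / d.+1%:R))).
  apply: enorm_le; first by rewrite divr_ge0.
  by move=> j; rewrite !mxE distrC ltW.
rewrite mulrCA ler_piMr// ler_pdivrMr ?ltr0n// mul1r ler_nat.
exact: leqnSn.
Qed.

End enorm.

Section support.
Context (R : realType) (d : nat) (dT : measure_display) (T : measurableType dT).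
Context (P : probability T R) (X : T -> 'rV[R]_d).
Context (mX : forall j, measurable_fun setT (fun w => X w ord0 j)).

(** Euclidean and sup-norm balls are nested in each other up to a factor, so the support can be
    described by the balls that generate the topology. *)
Lemma suppP x : supp P X x <-> forall e, 0 < e -> (0 < P (X @^-1` ball x e))%E.
Proof.
have mc rho : measurable [set w | cball x rho (X w)].
  have : measurable_fun setT (fun w => enorm (X w - x)).
    apply: measurableT_comp.
      by apply: continuous_measurable_fun; exact: sqrt_continuous.
    apply: measurable_sum => j; apply: measurable_funX.
    under eq_fun do rewrite !mxE.
    by apply: measurable_funB => //; exact: measurable_cst.
  move=> /(_ measurableT _ (measurable_itv `]-oo, rho])); rewrite setTI.
  by rewrite set_itvE.
have mb e : measurable (X @^-1` ball x e) by exact: measurable_preimage_ball.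
split=> [h e e0|h k k0].
  have [k ke] := exists_invSn_lt e0.
  apply: (lt_le_trans (h k.+1 isT)); apply: le_measure; rewrite ?inE//.
  by move=> w; exact: cball_sub_ball.
have e0 : 0 < (k%:R^-1 / d.+1%:R : R) by rewrite divr_gt0// invr_gt0 ltr0n.
apply: (lt_le_trans (h _ e0)); apply: le_measure; rewrite ?inE//.
by move=> w; apply: ball_sub_cball; rewrite invr_ge0.
Qed.

Lemma supp_closed : closed (supp P X).
Proof.
rewrite -openC openE => x /= /suppP/existsNP[e /not_implyP[e0 he]].
apply/nbhs_ballP; exists (e / 2) => /=; first by rewrite divr_gt0.
move=> y xy /= /suppP /(_ (e / 2)); rewrite divr_gt0// => /(_ isT) h.
apply: he; apply: (lt_le_trans h).
apply: le_measure; rewrite ?inE; try exact: measurable_preimage_ball.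
by move=> w yw; exact: (ball_split xy).
Qed.

(** A point outside the support has a null ball around it, and inside that a null ball with rational
    center and radius [k.+1%:R^-1] containing the point. There are countably many of these. *)
Lemma ae_supp : {ae P, forall w, supp P X (X w)}.
Proof.
pose F (p : 'rV[rat]_d * nat) := X @^-1` ball (map_mx ratr p.1 : 'rV[R]_d) p.2.+1%:R^-1.
have : {ae P, forall w, forall p, P (F p) = 0%E -> ~ F p w}.
  apply: ae_forall_countable => p.
  have [F0|] := eqVneq (P (F p)) 0%E; last by move=> /eqP ?; exact: aeW.
  exists (F p); split => //; first exact: measurable_preimage_ball.
  by move=> w /=; apply: contra_notP => nFw _.
apply: filterS => w hw; apply/suppP => e e0; rewrite lt0e measure_ge0 andbT.
apply/eqP => P0.
have [k ke] := exists_invSn_lt (divr_gt0 e0 (ltr0Sn _ 1)).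
have k0 : 0 < k.+1%:R^-1 :> R by rewrite invr_gt0.
have [q hq] := exists_rat_rV (X w) k0.
apply: (hw (q, k)); last exact: ball_sym.
apply: (subset_measure0 _ _ _ P0); try exact: measurable_preimage_ball.
move=> y qy; rewrite /= (splitr e).
exact: (ball_triangle (le_ball (ltW ke) hq) (le_ball (ltW ke) qy)).
Qed.

(** An empty support would contradict [ae_supp]. This serves the uniform statement, since a supremum
    over the empty set would be [-oo]. *)
Lemma supp_nonempty : supp P X !=set0.
Proof.
apply: contrapT => /forallNP h; have [A [mA PA hA]] := ae_supp.
have : (P setT <= P A)%E.
  apply: le_measure; rewrite ?inE// => w _; apply: hA => /=; exact: h.
by rewrite probability_setT PA lee_fin ler10.
Qed.

End support.

Section kernel.
Context (R : realType) (d : nat) (K : 'rV[R]_d -> R).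
Context (cK : continuous K).
Context (K0 : forall (x : 'rV[R]_d) j, 1 < `|x ord0 j| -> K x = 0).

Lemma kernel_unif_continuous (e : R) : 0 < e ->
  exists2 delta, 0 < delta & forall x y, ball x delta y -> `|K x - K y| <= e.
Proof.
move=> e0.
(* Half-width 2 leaves a margin of 1 around the cube outside which [K] vanishes: if [x] is outside
   [B] and [y] is within [delta < 1] of [x], both kernel values are 0. *)
pose B := [set v : 'rV[R]_d | forall j, v ord0 j \in `[(-2), 2]].
have cB : compact B.
  apply: (@rV_compact R d (fun=> `[(-2), 2]%classic)).
  by move=> _; exact: segment_compact.
pose good (delta : R) : set 'rV[R]_d :=
  [set x | forall y, ball x delta y -> `|K x - K y| <= e].
(* With the radius tending to 0 as a parameter, the covering form of compactness yields one radius
   valid on the whole cube. *)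
have : \forall delta \near (0 : R)^'+, B `<=` good delta.
  move/compact_near_coveringP : cB; apply => x Bx.
  have /nbhs_ballP[t /= t0 ht] : \forall y \near x, `|K x - K y| < e / 2.
    by have /cvgrPdist_lt := @cK x; apply; rewrite divr_gt0.
  exists (ball x (t / 2), [set delta | delta < t / 2]) => /=.
    split; first by apply: nbhsx_ballx; rewrite divr_gt0.
    by apply: nbhs_right_lt; rewrite divr_gt0.
  move=> [y delta] /= [xy dt] z yz.
  have h1 : `|K x - K y| < e / 2 by apply: ht; apply: le_ball xy; lra.
  have h2 : `|K x - K z| < e / 2.
    by apply: ht; rewrite (splitr t); exact: (ball_triangle xy (le_ball (ltW dt) yz)).
  rewrite (_ : K y - K z = (K x - K z) - (K x - K y)); last by ring.
  by rewrite (le_trans (ler_normB _ _))// (splitr e) lerD// ltW.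
move=> h.
have [delta [hd d0 d1]] : exists delta, [/\ B `<=` good delta, 0 < delta & delta < 1].
  near (0 : R)^'+ => delta; exists delta; split.
  - by near: delta.
  - by near: delta; exact: nbhs_right_gt.
  - by near: delta; exact: nbhs_right_lt.
exists delta => // x y xy.
have [Bx|/existsNP[j]] := pselect (B x); first exact: hd.
rewrite in_itv/= -ler_norml => /negP; rewrite -ltNge => xj.
have /ball_rVP[_ /(_ j) xyj] := xy.
rewrite (@K0 x j); last by lra.
rewrite (@K0 y j) ?subrr ?normr0 ?ltW//.
have := ler_normD (y ord0 j) (x ord0 j - y ord0 j).
by rewrite addrC subrK; lra.
Unshelve. all: by end_near. Qed.

(** The condition bears on [u - x] alone, so the same modulus serves for moving the base point and
    for moving the observation. *)
Lemma Kh_unif_continuous k (e : R) : 0 < e -> exists2 delta, 0 < delta &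
  forall u x v y, ball (u - x) delta (v - y) -> `|Kh K k u x - Kh K k v y| <= e.
Proof.
move=> /kernel_unif_continuous[delta d0 h].
have hk0 : 0 < hk R k by rewrite invr_gt0 exprn_gt0.
exists (hk R k * delta) => [|u x v y /ball_rVP[_ xy]]; first exact: mulr_gt0.
apply: h; apply/ball_rVP; split=> // j; rewrite !mxE -mulrBr normrM.
rewrite ger0_norm ?invr_ge0 ?ltW// -ltr_pdivlMl ?invr_gt0// invrK.
by have := xy j; rewrite !mxE.
Qed.

Lemma ball_subl (u x y : 'rV[R]_d) (e : R) : ball x e y -> ball (u - x) e (u - y).
Proof.
move=> /ball_rVP[e0 h]; apply/ball_rVP; split=> // j; rewrite !mxE.
by rewrite opprD addrACA subrr add0r opprK addrC distrC.
Qed.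

Lemma continuous_Kh k u : continuous (Kh K k u).
Proof.
move=> x; apply/(@cvgrPdist_le _ _ _ (nbhs x) (nbhs_filter x)) => e.
move=> /(Kh_unif_continuous k)[delta d0 h]; apply/nbhs_ballP.
by exists delta => // y /(ball_subl u); exact: h.
Qed.

Lemma continuous_Khl k x : continuous (fun u => Kh K k u x).
Proof.
move=> u; apply/(@cvgrPdist_le _ _ _ (nbhs u) (nbhs_filter u)) => e.
move=> /(Kh_unif_continuous k)[delta d0 h]; apply/nbhs_ballP.
exists delta => // v /ball_rVP[_ uv]; apply: h; apply/ball_rVP; split=> // j.
by have := uv j; rewrite !mxE opprD addrACA subrr addr0.
Qed.

End kernel.

(** * Joint convergence of kernel averages *)

(** The oscillation of [A n] may carry a factor [c n], in the application the average of the
    absolute weights. This factor is eventually below [C + 1], so the passage through a nearby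
    rational point costs at most [e / 3] for each of three terms. *)
Lemma equicontinuous_joint_cvg (R : realType) (d : nat)
  (A : nat -> 'rV[R]_d -> R) (G : 'rV[R]_d -> R) (c : nat -> R) (C : R) :
  c @ \oo --> C -> 0 <= C ->
  (forall e, 0 < e -> exists2 delta, 0 < delta & forall x y, ball x delta y ->
    (forall n, `|A n x - A n y| <= c n * e) /\ `|G x - G y| <= C * e) ->
  (forall q : 'rV[rat]_d, A n (map_mx ratr q) @[n --> \oo] --> G (map_mx ratr q)) ->
  forall x, A p.1 p.2 @[p --> filter_prod \oo (nbhs x)] --> G x.
Proof.
move=> cC C0 AE Aq x; apply/cvgrPdist_le => e e0.
have C1 : 0 < 3 * (C + 1) by rewrite mulr_gt0// ltr_wpDl.
have [delta delta0 h] := AE (e / (3 * (C + 1))) (divr_gt0 e0 C1).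
have d20 : 0 < delta / 2 by rewrite divr_gt0.
have [q hq] := exists_rat_rV x d20.
pose N1 := [set n | `|G (map_mx ratr q) - A n (map_mx ratr q)| <= e / 3].
pose N2 := [set n | c n <= C + 1].
have oN1 : \oo N1.
  by have /cvgrPdist_le := Aq q; apply; rewrite divr_gt0.
have oN2 : \oo N2.
  by apply: (cvgr_le _ cC); rewrite ltrDl.
exists (N1 `&` N2, ball x (delta / 2)) => /=.
  by split; [exact: filterI|exact: nbhsx_ballx].
move=> [n y] /= [[N1n N2n] xy].
have xq : ball x delta (map_mx ratr q) by apply: le_ball hq; lra.
have yq : ball y delta (map_mx ratr q).
  by rewrite (splitr delta); exact: (ball_triangle (ball_sym xy) hq).
have [_ h1] := h _ _ xq; have [/(_ n) h2 _] := h _ _ yq.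
have e3 : 0 <= e / (3 * (C + 1)) by rewrite ltW// divr_gt0.
have e3E : (C + 1) * (e / (3 * (C + 1))) = e / 3.
  by field; rewrite gt_eqF// ltr_wpDl.
have h1' : `|G x - G (map_mx ratr q)| <= e / 3.
  by apply: (le_trans h1); rewrite -e3E ler_wpM2r// lerDl.
have h2' : `|A n y - A n (map_mx ratr q)| <= e / 3.
  by apply: (le_trans h2); rewrite -e3E ler_wpM2r.
rewrite /N1/= in N1n.
have -> : G x - A n y = (G x - G (map_mx ratr q)) +
   (G (map_mx ratr q) - A n (map_mx ratr q)) - (A n y - A n (map_mx ratr q)) by ring.
rewrite (le_trans (ler_normB _ _))// (le_trans (lerD (ler_normD _ _) (lexx _)))//.
lra.
Qed.

Section kernel_average.
Context (R : realType) (d : nat) (dT : measure_display) (T : measurableType dT).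
Context (P : probability T R) (X : nat -> T -> 'rV[R]_d) (Y : nat -> T -> R).
Context (K : 'rV[R]_d -> R).
Context (mX : forall i j, measurable_fun setT (fun w => X i w ord0 j)).
Context (mY : forall i, measurable_fun setT (Y i)).
Context (cK : continuous K) (K_ge0 : forall x, 0 <= K x) (K_le1 : forall x, K x <= 1).
Context (K0 : forall (x : 'rV[R]_d) j, 1 < `|x ord0 j| -> K x = 0).

Lemma measurable_Kh k x : measurable_fun setT (fun w => Kh K k (X 0%N w) x).
Proof.
apply: (measurable_continuous_comp (mX 0%N) (g := fun u => Kh K k u x)).
exact: continuous_Khl.
Qed.

Section weighted.
Context (phi : R -> R) (mphi : measurable_fun setT phi).
Context (iphi : P.-integrable setT (fun w => (phi (Y 0%N w))%:E)).

Lemma integrable_phi_Kh k x :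
  P.-integrable setT (EFin \o (fun w => phi (Y 0%N w) * Kh K k (X 0%N w) x)).
Proof.
apply: le_integrable iphi => //.
  apply/measurable_EFinP; apply: measurable_funM.
    exact: measurableT_comp.
  exact: measurable_Kh.
move=> w _ /=; rewrite lee_fin normrM [X in _ * X]ger0_norm; last exact: K_ge0.
by rewrite ler_piMr//; exact: K_le1.
Qed.

Lemma mean_phi_Kh_continuous k (e : R) : 0 < e -> exists2 delta, 0 < delta &
  forall x y, ball x delta y ->
    `|\int[P]_w (phi (Y 0%N w) * Kh K k (X 0%N w) x) -
      \int[P]_w (phi (Y 0%N w) * Kh K k (X 0%N w) y)| <=
    (\int[P]_w `|phi (Y 0%N w)|) * e.
Proof.
move=> /(Kh_unif_continuous cK K0 k)[delta d0 h]; exists delta => // x y xy.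
have ix := integrable_phi_Kh k x; have iy := integrable_phi_Kh k y.
have iB : P.-integrable setT (EFin \o (fun w => phi (Y 0%N w) * Kh K k (X 0%N w) x -
    phi (Y 0%N w) * Kh K k (X 0%N w) y)) by exact: (integrableB measurableT ix iy).
rewrite -RintegralB// (le_trans (le_normr_Rintegral _ _))//.
have iN := integrable_norm iphi.
rewrite -RintegralZr//; apply: le_Rintegral => //.
- exact: integrable_norm iB.
- exact: (integrableZr measurableT e iN).
move=> w _; rewrite /= -mulrBr normrM ler_wpM2l//.
by apply: h; exact: ball_subl.
Qed.

Context (statP : stationary P X Y) (ergP : ergodic P X Y).

(** Taking [phi] to be the identity treats the numerators of the estimator, and [phi] constant 1 its
    denominators. The law of large numbers is used for [|phi|], which controls the equicontinuity,
    and for countably many pairs of a scale and a rational base point. *)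
Lemma ae_kernel_average_cvg : {ae P, forall w, forall k x,
  p.1%:R^-1 * \sum_(j < p.1) phi (Y j w) * Kh K k (X j w) p.2
    @[p --> filter_prod \oo (nbhs x)] -->
  \int[P]_w (phi (Y 0%N w) * Kh K k (X 0%N w) x)}.
Proof.
pose seqT := g_sigma_algebraType (@seq_cyl R d).
have mphi2 : measurable_fun setT (fun z : seqT => phi (z 0%N).2).
  by apply: measurableT_comp => //; exact: measurable_seq_snd.
have h1 : {ae P, forall w, n%:R^-1 * \sum_(j < n) `|phi (Y j w)| @[n --> \oo] -->
    \int[P]_w `|phi (Y 0%N w)|}.
  apply: (lln mX mY statP ergP (f := fun s => `|phi s.2|)).
    exact: measurableT_comp.
  exact: integrable_norm iphi.
have h2 : {ae P, forall w, forall i : nat * 'rV[rat]_d, n%:R^-1 *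
    \sum_(j < n) phi (Y j w) * Kh K i.1 (X j w) (map_mx ratr i.2) @[n --> \oo] -->
    \int[P]_w (phi (Y 0%N w) * Kh K i.1 (X 0%N w) (map_mx ratr i.2))}.
  apply: ae_forall_countable => -[k q] /=.
  apply: (lln mX mY statP ergP
    (f := fun s => phi s.2 * Kh K k s.1 (map_mx ratr q))); last exact: integrable_phi_Kh.
  apply: measurable_funM => //.
  exact: (measurable_continuous_comp (T := seqT) (X := fun z => (z 0%N).1)
    (@measurable_seq_fst R d 0) (@continuous_Khl _ _ _ cK K0 k (map_mx ratr q))).
apply: filterS2 h1 h2 => w hC hq k.
apply: (equicontinuous_joint_cvg (A := fun n x => n%:R^-1 *
   \sum_(j < n) phi (Y j w) * Kh K k (X j w) x) hC) => [||q].
- by apply: Rintegral_ge0 => *; exact: normr_ge0.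
- move=> e e0.
  have [d1 d10 hd1] := mean_phi_Kh_continuous k e0.
  have [d2 d20 hd2] := Kh_unif_continuous cK K0 k e0.
  exists (Num.min d1 d2); first by rewrite lt_min d10.
  move=> x y xy; split; last first.
    by apply: hd1; apply: le_ball xy; rewrite ge_min lexx.
  move=> n; rewrite -mulrBr normrM ger0_norm ?invr_ge0// -mulrA ler_wpM2l ?invr_ge0//.
  rewrite -sumrB mulr_suml (le_trans (ler_norm_sum _ _ _))//; apply: ler_sum => j _.
  rewrite -mulrBr normrM ler_wpM2l//; apply: hd2; apply: ball_subl.
  by apply: le_ball xy; rewrite ge_min lexx orbT.
- exact: (hq (k, q)).
Qed.

End weighted.
End kernel_average.

(** * Truncated series *)

Section truncated_series.
Context (R : realType) (L : R).
Context (L0 : 0 < L).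

Lemma trunc_bound_gt0 k : 0 < L * (2 ^+ k)^-1.
Proof. by rewrite mulr_gt0// invr_gt0 exprn_gt0. Qed.

Lemma norm_trunc k (a b : R) : `|trunc L k a b| <= L * (2 ^+ k)^-1.
Proof.
rewrite /trunc normrM normr_sg.
have c0 := trunc_bound_gt0 k.
rewrite [X in _ * X]ger0_norm; last by rewrite le_min normr_ge0 ltW.
by case: (_ != 0); [rewrite mul1r ge_min lexx orbT|rewrite mul0r ltW].
Qed.

(** This is [a - b] clamped to a symmetric interval. In this form continuity and measurability are
    visible, whereas the sign is discontinuous at 0. *)
Lemma truncE k (a b : R) : trunc L k a b =
  Num.max (- (L * (2 ^+ k)^-1)) (Num.min (a - b) (L * (2 ^+ k)^-1)).
Proof.
rewrite /trunc; have := trunc_bound_gt0 k; set c := L * _ => c0.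
have [ab|ab|->] := ltgtP (a - b) 0.
- rewrite ltr0_sg// ltr0_norm// mulN1r oppr_min opprK [RHS]maxC [in RHS]min_l//.
  by rewrite ltW// (lt_trans ab).
- rewrite gtr0_sg// gtr0_norm// mul1r max_r//.
  have cN : - c <= 0 by rewrite oppr_le0 ltW.
  by rewrite le_min (le_trans cN (ltW ab)) (le_trans cN (ltW c0)).
- by rewrite sgr0 mul0r min_l ?ltW// max_r// oppr_le0 ltW.
Qed.

Lemma cvg_trunc (I : Type) (F : set_system I) {FF : Filter F} k
  (f g : I -> R) (a b : R) : f @ F --> a -> g @ F --> b ->
  trunc L k (f i) (g i) @[i --> F] --> trunc L k a b.
Proof.
move=> fa gb; rewrite truncE; under eq_fun do rewrite truncE.
set c := L * _.
have ct : continuous (fun t : R => Num.max (- c) (Num.min t c)).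
  move=> t; apply: (@continuous_max R R (cst (- c)) (fun t => Num.min t c)).
    exact: cvg_cst.
  by apply: (@continuous_min R R id (cst c)); [exact: cvg_id|exact: cvg_cst].
exact: (cvg_comp _ _ (cvgB fa gb) (ct (a - b))).
Qed.

Lemma measurable_trunc (dT : measure_display) (T : measurableType dT) k (f g : T -> R) :
  measurable_fun setT f -> measurable_fun setT g ->
  measurable_fun setT (fun w => trunc L k (f w) (g w)).
Proof.
move=> mf mg; under eq_fun do rewrite truncE.
apply: measurable_maxr; first exact: measurable_cst.
apply: measurable_minr; last exact: measurable_cst.
exact: measurable_funB.
Qed.

(** The index [n] is excluded, so [mhat] corresponds to [(N n).+1], and the series in [mstar] is the
    limit in [n]. *)
Definition trunc_sum (a : nat -> R) (n : nat) : R :=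
  \sum_(2 <= k < n) trunc L k (a k) (a k.-1).

Lemma trunc_sum_tail (a : nat -> R) (m n : nat) : (2 <= m)%N -> (m <= n)%N ->
  `|trunc_sum a n - trunc_sum a m| <= 2 * L * (2 ^+ m)^-1.
Proof.
move=> m2 mn.
(* The bound is sharpened by the remaining geometric tail so that the induction closes: adding a
   term of size at most [L / 2 ^+ n] halves that tail. *)
suff : `|trunc_sum a n - trunc_sum a m| <= 2 * L * (2 ^+ m)^-1 - 2 * L * (2 ^+ n)^-1.
  move=> /le_trans; apply; rewrite gerBl.
  by rewrite -mulrA mulr_ge0// ltW// trunc_bound_gt0.
elim: n mn => [|n IH].
  by rewrite leqn0 => /eqP m0; rewrite m0 in m2.
rewrite leq_eqVlt => /predU1P[<-|]; first by rewrite !subrr normr0.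
rewrite ltnS => mn; rewrite /trunc_sum big_nat_recr/=; last exact: leq_trans mn.
rewrite addrAC (le_trans (ler_normD _ _))//.
apply: (le_trans (lerD (IH mn) (norm_trunc _ _ _))).
rewrite exprS invfM; lra.
Qed.

(** The sum is empty up to index 2, and the tail bound from there is [L / 2]. Independence of [a]
    and [n] makes this a dominating constant later on. *)
Lemma norm_trunc_sum (a : nat -> R) (n : nat) : `|trunc_sum a n| <= L.
Proof.
have [n2|n2] := leqP n 2; first by rewrite /trunc_sum big_geq// normr0 ltW.
have := trunc_sum_tail a (leqnn 2) (ltnW n2).
rewrite {2}/trunc_sum big_geq// subr0 => /le_trans; apply.
have -> : 2 * L * (2 ^+ 2)^-1 = L / 2 by field.
by rewrite ler_pdivrMr// ler_peMr ?ler1n// ltW.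
Qed.

Lemma trunc_tail_small (e : R) : 0 < e ->
  exists2 m, (2 <= m)%N & 2 * L * (2 ^+ m)^-1 < e.
Proof.
move=> e0; near \oo => m; exists m; first by near: m; exact: nbhs_infty_ge.
near: m.
have : (2 * L) * (2^-1) ^+ n @[n --> \oo] --> (0 : R).
  by apply: cvg_geometric; rewrite gtr0_norm ?invr_gt0// invf_lt1// ltr1n.
move=> /cvgr_lt /(_ _ e0); apply: filterS => n.
by rewrite exprVn.
Unshelve. all: by end_near. Qed.

Lemma is_cvg_trunc_sum (a : nat -> R) : cvgn (trunc_sum a).
Proof.
apply/cauchy_cvgP/cauchy_exP => e /trunc_tail_small[m m2 me].
exists (trunc_sum a m); exists m => // n /= mn.
rewrite /ball/= distrC; exact: (le_lt_trans (trunc_sum_tail _ m2 mn)).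
Qed.

Lemma lim_trunc_sum_tail (a : nat -> R) (m : nat) : (2 <= m)%N ->
  `|limn (trunc_sum a) - trunc_sum a m| <= 2 * L * (2 ^+ m)^-1.
Proof.
move=> m2; have h : `|trunc_sum a n - trunc_sum a m| @[n --> \oo] -->
    `|limn (trunc_sum a) - trunc_sum a m|.
  by apply: cvg_norm; apply: cvgB; [exact: is_cvg_trunc_sum|exact: cvg_cst].
rewrite -(cvg_lim _ h)//; apply: limr_le; first by apply/cvg_ex; eexists; exact: h.
by exists m => // n /= mn; exact: trunc_sum_tail.
Qed.

Lemma norm_lim_trunc_sum (a : nat -> R) : `|limn (trunc_sum a)| <= L.
Proof.
have := lim_trunc_sum_tail a (leqnn 2).
rewrite /trunc_sum big_geq// subr0 => /le_trans; apply.
have -> : 2 * L * (2 ^+ 2)^-1 = L / 2 by field.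
by rewrite ler_pdivrMr// ler_peMr ?ler1n// ltW.
Qed.

(** Beyond a fixed index [m] both series are below [e / 3] whatever their arguments; the finitely
    many terms before [m] converge because clamping is continuous. The general filter allows the
    base point and the number of terms to vary together. *)
Lemma trunc_sum_cvg (I : Type) (F : set_system I) {FF : Filter F}
  (a : I -> nat -> R) (alpha : nat -> R) (N : I -> nat) :
  (forall k, (0 < k)%N -> a i k @[i --> F] --> alpha k) ->
  (forall M, \forall i \near F, (M <= N i)%N) ->
  a i 1%N + trunc_sum (a i) (N i).+1 @[i --> F] -->
    alpha 1%N + limn (trunc_sum alpha).
Proof.
move=> aF NF; apply: cvgD; first exact: aF.
apply/cvgrPdist_le => e e0.
have e30 : 0 < e / 3 by rewrite divr_gt0.
have [m m2 me] := trunc_tail_small e30.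
have /cvgrPdist_le /(_ _ e30) : trunc_sum (a i) m @[i --> F] --> trunc_sum alpha m.
  rewrite /trunc_sum; under eq_fun do rewrite big_nat; rewrite big_nat.
  apply: cvg_big => [|k /andP[k2 _]]; first exact: add_continuous.
  by apply: cvg_trunc; apply: aF; [exact: ltnW|case: k k2 => [|[]]].
apply: filterS2 (NF m) => i mN h.
have h1 := lim_trunc_sum_tail alpha m2.
have h2 := trunc_sum_tail (a i) m2 (leqW mN).
have -> : limn (trunc_sum alpha) - trunc_sum (a i) (N i).+1 =
  (limn (trunc_sum alpha) - trunc_sum alpha m) + (trunc_sum alpha m - trunc_sum (a i) m) -
  (trunc_sum (a i) (N i).+1 - trunc_sum (a i) m) by ring.
rewrite (le_trans (ler_normB _ _))// (le_trans (lerD (ler_normD _ _) (lexx _)))//.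
lra.
Qed.

End truncated_series.

(** * The estimator *)

Section estimator.
Context (R : realType) (d : nat) (dT : measure_display) (T : measurableType dT).
Context (P : probability T R) (X : nat -> T -> 'rV[R]_d) (Y : nat -> T -> R).
Context (K : 'rV[R]_d -> R) (b r L : R) (N : nat -> nat).
Context (mX : forall i j, measurable_fun setT (fun w => X i w ord0 j)).
Context (mY : forall i, measurable_fun setT (Y i)).
Context (iY : P.-integrable setT (fun w => (Y 0%N w)%:E)).
Context (cK : continuous K) (K_ge0 : forall x, 0 <= K x) (K_le1 : forall x, K x <= 1).
Context (K0 : forall (x : 'rV[R]_d) j, 1 < `|x ord0 j| -> K x = 0).
Context (b0 : 0 < b) (r0 : 0 < r) (Kb : forall x, cball 0 r x -> b <= K x).
Context (L0 : 0 < L) (Noo : forall M : nat, \forall n \near \oo, (M <= N n)%N).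

Local Notation S := (supp P (X 0%N)).
Local Notation M := (Mstar K P (X 0%N) (Y 0%N)).
Local Notation m := (mstar K P (X 0%N) (Y 0%N) L).
Local Notation mh := (mhat K X Y N L).
Local Notation num k x := (\int[P]_w (Y 0%N w * Kh K k (X 0%N w) x)).
Local Notation den k x := (\int[P]_w (Kh K k (X 0%N w) x)).

Lemma integrable_Kh k x : P.-integrable setT (EFin \o (fun w => Kh K k (X 0%N w) x)).
Proof.
have i1 := finite_measure_integrable_cst P (1 : R) measurableT.
have := integrable_phi_Kh mX mY cK K_ge0 K_le1 K0
  (measurable_cst (1 : R)) i1 k x.
by under eq_fun do rewrite mul1r.
Qed.

(** The kernel is at least [b] near the origin, so the integral is at least [b] times the mass of a
    ball around [x], positive on the support. *)
Lemma den_gt0 k x : S x -> 0 < den k x.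
Proof.
move=> Sx.
have hk0 : 0 < hk R k by rewrite invr_gt0 exprn_gt0.
(* The sup-norm radius [r / d.+1%:R] fits into the Euclidean ball of radius [r]; the factor [hk R k]
   undoes the rescaling in [Kh]. *)
pose e := hk R k * (r / d.+1%:R).
have e0 : 0 < e by rewrite mulr_gt0// divr_gt0.
have /(_ _ e0) PA := (suppP P (mX 0%N) x).1 Sx.
set A := _ @^-1` _ in PA.
have mA : measurable A by exact: measurable_preimage_ball.
have AK w : A w -> b <= Kh K k (X 0%N w) x.
  move=> /ball_rVP[_ h]; apply: Kb; apply: ball_sub_cball; first exact: ltW.
  apply/ball_rVP; split; first by rewrite divr_gt0.
  move=> j; rewrite !mxE sub0r normrN normrM ger0_norm ?invr_ge0 ?ltW//.
  by rewrite -ltr_pdivlMl ?invr_gt0// invrK distrC.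
have fden : (\int[P]_w (Kh K k (X 0%N w) x)%:E)%E \is a fin_num.
  exact: integrable_fin_num (integrable_Kh k x).
rewrite /Rintegral fine_gt0// ltey_eq fden/= andbT.
have mKh := measurable_Kh mX cK K0 k x.
apply: (@lt_le_trans _ _ (\int[P]_(w in A) b%:E)%E).
  by rewrite integral_cst// mule_gt0.
apply: (@le_trans _ _ (\int[P]_(w in A) (Kh K k (X 0%N w) x)%:E)%E).
  apply: ge0_le_integral => //.
  - by move=> w _; rewrite lee_fin ltW.
  - by apply/measurable_EFinP; exact: measurable_funTS.
apply: ge0_subset_integral => //; first exact/measurable_EFinP.
by move=> w _; rewrite lee_fin; exact: K_ge0.
Qed.

Lemma num_continuous k : continuous (fun x => num k x).
Proof.
move=> x; apply/(@cvgrPdist_le _ _ _ (nbhs x) (nbhs_filter x)) => e e0.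
set C := \int[P]_w `|Y 0%N w|.
have C0 : 0 < C + 1 by rewrite ltr_wpDl// Rintegral_ge0.
have [delta d0 h] := mean_phi_Kh_continuous mX mY cK K_ge0 K_le1 K0
  (@measurable_id _ _ _) iY k (divr_gt0 e0 C0).
apply/nbhs_ballP; exists delta => // y /h /le_trans; apply.
rewrite mulrCA; apply: ler_piMr; first exact: ltW.
by rewrite ler_pdivrMr// mul1r lerDl.
Qed.

Lemma den_continuous k : continuous (fun x => den k x).
Proof.
move=> x; apply/(@cvgrPdist_le _ _ _ (nbhs x) (nbhs_filter x)) => e e0.
have i1 := finite_measure_integrable_cst P (1 : R) measurableT.
have [delta d0 h] := mean_phi_Kh_continuous mX mY cK K_ge0 K_le1 K0
  (measurable_cst (1 : R)) i1 k e0.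
have C1 : \int[P]_w `|(cst 1 : R -> R) (Y 0%N w)| = 1.
  rewrite (@eq_Rintegral _ _ _ P setT (cst 1)); last by move=> w _; rewrite /= normr1.
  by rewrite Rintegral_cst// mul1r [X in fine X](@probability_setT _ _ _ P).
have E z : \int[P]_w ((cst 1 : R -> R) (Y 0%N w) * Kh K k (X 0%N w) z) = den k z.
  by apply: eq_Rintegral => w _; rewrite mul1r.
apply/nbhs_ballP; exists delta => // y /h.
by rewrite C1 mul1r !E.
Qed.

Lemma Mstar_continuous k x : S x -> M k y @[y --> x] --> M k x.
Proof.
move=> Sx; have dx : den k x != 0 by rewrite gt_eqF// den_gt0.
exact: (cvgM (@num_continuous k x) (cvgV dx (@den_continuous k x))).
Qed.

Lemma mstar_continuous x : S x -> m y @[y --> x] --> m x.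
Proof.
move=> Sx.
(* The number of terms and the base point vary together, so that letting the
   former tend to infinity afterwards yields the continuity of the full sum. *)
have joint : M 1 p.2 + trunc_sum L (M ^~ p.2) p.1.+1
    @[p --> filter_prod \oo (nbhs x)] --> m x.
  apply: (trunc_sum_cvg L0 (a := fun p k => M k p.2) (alpha := M ^~ x) (N := fst)).
    by move=> k _; apply: (cvg_comp _ _ cvg_snd); exact: Mstar_continuous.
  by move=> j; exact: (cvg_fst (nbhs_infty_ge j)).
apply/(@cvgrPdist_le _ _ _ (nbhs x) (nbhs_filter x)) => e e0.
have /cvgrPdist_le /(_ _ e0) [[A B] /= [oA nB] AB] := joint.
apply: filterS nB => y By.
have my : `|m x - (M 1 y + trunc_sum L (M ^~ y) n.+1)| @[n --> \oo] --> `|m x - m y|.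
  apply: cvg_norm; apply: cvgB; first exact: cvg_cst.
  apply: (trunc_sum_cvg L0 (a := fun _ k => M k y) (alpha := M ^~ y) (N := id)).
    by move=> k _; exact: cvg_cst.
  by move=> j; exact: nbhs_infty_ge.
rewrite -(cvg_lim _ my)//; apply: limr_le; first by apply/cvg_ex; eexists; exact: my.
by apply: filterS oA => n An; exact: (AB (n, y)).
Qed.

Lemma measurable_ratio (f g : T -> R) : measurable_fun setT f ->
  measurable_fun setT g -> (forall w, 0 <= g w) ->
  measurable_fun setT (fun w => f w / g w).
Proof.
move=> mf mg g0; apply: measurable_funM => //.
(* [powR] also sends 0 to 0 with exponent -1, as the inverse does. *)
under eq_fun do rewrite -powR_inv1//.
exact: (measurableT_comp (measurable_powR (-1 : R)) mg).
Qed.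

Lemma measurable_Mstar k : measurable_fun setT (fun w => M k (X 0%N w)).
Proof.
apply: measurable_ratio.
- exact: (measurable_continuous_comp (mX 0%N) (@num_continuous k)).
- exact: (measurable_continuous_comp (mX 0%N) (@den_continuous k)).
- by move=> w; apply: Rintegral_ge0 => v _; exact: K_ge0.
Qed.

Lemma measurable_trunc_sum (a : T -> nat -> R) n :
  (forall k, measurable_fun setT (a^~ k)) ->
  measurable_fun setT (fun w => trunc_sum L (a w) n).
Proof.
by move=> ma; apply: measurable_sum => k; exact: measurable_trunc.
Qed.

Lemma measurable_mstar : measurable_fun setT (fun w => m (X 0%N w)).
Proof.
apply: measurable_funD; first exact: measurable_Mstar.
apply: (measurable_fun_cvg (h := fun n w => trunc_sum L (M ^~ (X 0%N w)) n)).
  by move=> n; apply: measurable_trunc_sum => k; exact: measurable_Mstar.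
by move=> w _; exact: is_cvg_trunc_sum.
Qed.

Lemma measurable_Mhat n k w : measurable_fun setT (fun v => Mhat K X Y n k w (X 0%N v)).
Proof.
have mKh j : measurable_fun setT (fun v => Kh K k (X j w) (X 0%N v)).
  apply: (measurable_continuous_comp (mX 0%N)).
  exact: continuous_Kh.
apply: measurable_ratio.
- by apply: measurable_sum => j; apply: measurable_funM => //; exact: measurable_cst.
- exact: measurable_sum.
- by move=> v; apply: sumr_ge0 => j _; exact: K_ge0.
Qed.

Lemma measurable_mhat n w : measurable_fun setT (fun v => mh n w (X 0%N v)).
Proof.
apply: measurable_funD; first exact: measurable_Mhat.
by apply: measurable_trunc_sum => k; exact: measurable_Mhat.
Qed.

Context (statP : stationary P X Y) (ergP : ergodic P X Y).

(** Once this holds at a sample point, pointwise and uniform convergence follow there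
    deterministically, and so does mean square convergence given an eventual uniform bound. Only the
    limit point is required to lie in the support; the moving base point is free. *)
Definition joint_consistent w := forall x, S x ->
  mh p.1 w p.2 @[p --> filter_prod \oo (nbhs x)] --> m x.

Lemma ae_joint_consistent : {ae P, forall w, joint_consistent w}.
Proof.
have i1 := finite_measure_integrable_cst P (1 : R) measurableT.
have h1 := ae_kernel_average_cvg mX mY cK K_ge0 K_le1 K0
  (@measurable_id _ _ _) iY statP ergP.
have h2 := ae_kernel_average_cvg mX mY cK K_ge0 K_le1 K0
  (measurable_cst (1 : R)) i1 statP ergP.
apply: filterS2 h1 h2 => w h1 h2 x Sx.
have Mh k : Mhat K X Y p.1 k w p.2 @[p --> filter_prod \oo (nbhs x)] --> M k x.
  have {h1}h1 := h1 k x; have {h2} := h2 k x.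
  under [\int[P]_w _]eq_Rintegral do rewrite mul1r.
  have dx : den k x != 0 by rewrite gt_eqF// den_gt0.
  move=> h2; apply: (cvg_trans _ (cvgM h1 (cvgV dx h2))).
  (* The factors [n%:R^-1] cancel in the ratio; for [n = 0] both numerators vanish, and with them
     both ratios. *)
  apply: near_eq_cvg; apply: nearW => -[n y] /=.
  rewrite /Mhat; under [\sum_(j < n) 1 * _]eq_bigr do rewrite mul1r.
  case: n => [|n]; first by rewrite !big_ord0 mulr0 mul0r.
  by rewrite -mulf_div divff ?mul1r// invr_eq0 pnatr_eq0.
apply: (trunc_sum_cvg L0 (a := fun p k => Mhat K X Y p.1 k w p.2) (alpha := M ^~ x)
   (N := N \o fst)) => [k _|j]; first exact: Mh.
exact: (cvg_fst (Noo j)).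
Qed.

Lemma joint_consistent_pointwise w x : joint_consistent w -> S x ->
  mh n w x @[n --> \oo] --> m x.
Proof.
move=> hw Sx; have nx : (n, x) @[n --> \oo] --> filter_prod \oo (nbhs x).
  move=> A [[B C] /= [oB nC] BC]; apply: filterS oB => n Bn.
  by apply: BC; split => //; exact: nbhs_singleton.
exact: (cvg_comp _ _ nx (hw x Sx)).
Qed.

(** For [y] near [x] and [n] large, the estimate at [y] and [m y] are both within [e / 2] of [m x];
    the first by joint convergence, the second by continuity. Compactness of the support makes the
    threshold on [n] uniform. *)
Lemma joint_consistent_uniform w (B e : R) : joint_consistent w ->
  (forall x, S x -> enorm x <= B) -> 0 < e ->
  \forall n \near \oo, forall x, S x -> `|mh n w x - m x| <= e.
Proof.
move=> hw SB e0.
have cS : compact S.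
  have cB : compact [set v : 'rV[R]_d | forall j, v ord0 j \in `[(- B), B]].
    apply: (@rV_compact R d (fun=> `[(- B), B]%classic)).
    by move=> _; exact: segment_compact.
  apply: (subclosed_compact _ cB); first exact: supp_closed (mX 0%N).
  move=> x Sx j; rewrite in_itv/= -ler_norml.
  exact: le_trans (coord_le_enorm _ _) (SB x Sx).
move/compact_near_coveringP : cS; apply => x Sx.
have e20 : 0 < e / 2 by rewrite divr_gt0.
have /cvgrPdist_le /(_ _ e20) [[A C] /= [oA nC] AC] := hw x Sx.
have /(@cvgrPdist_le _ _ _ (nbhs x) (nbhs_filter x)) /(_ _ e20) nD := mstar_continuous Sx.
exists (C `&` [set y | `|m x - m y| <= e / 2], A) => /=.
  by split => //; exact: filterI.
move=> [y n] /= [[Cy Dy] An].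
have := AC (n, y) (conj An Cy); rewrite /= => h.
have dist_split (p q s : R) : q - s = (p - s) - (p - q) by ring.
by rewrite (dist_split (m x)) (le_trans (ler_normB _ _))// (splitr e) lerD.
Qed.

Lemma joint_consistent_L2 w (C : R) : joint_consistent w ->
  (\forall n \near \oo, forall x, S x -> `|mh n w x - m x| <= C) ->
  (\int[P]_v ((mh n w (X 0%N v) - m (X 0%N v)) ^+ 2)%:E)%E @[n --> \oo] --> 0%E.
Proof.
(* The bound holds from [n0] on, while domination is required at every index; hence the shift. *)
move=> hw [n0 _ hC]; rewrite -(cvg_shiftn n0).
have aeS := ae_supp P (mX 0%N).
have [|||||_ _] := @dominated_convergence _ _ _ P setT measurableT
  (fun n v => ((mh (n + n0)%N w (X 0%N v) - m (X 0%N v)) ^+ 2)%:E) (cst 0%E)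
  (cst (C ^+ 2)%:E).
- move=> n; apply/measurable_EFinP; apply: measurable_funX.
  by apply: measurable_funB; [exact: measurable_mhat|exact: measurable_mstar].
- exact: measurable_cst.
- apply: filterS aeS => v Sv _; apply: cvg_EFin; first exact: nearW.
  have h := joint_consistent_pointwise hw Sv.
  have h' : mh (n + n0)%N w (X 0%N v) - m (X 0%N v) @[n --> \oo] --> (0 : R).
    rewrite -(subrr (m (X 0%N v))); apply: cvgB; last exact: cvg_cst.
    by rewrite (cvg_shiftn n0 (fun n => mh n w (X 0%N v))).
  have h2 := cvgM h' h'; rewrite mulr0 in h2.
  exact: h2.
- exact: (finite_measure_integrable_cst P (C ^+ 2) measurableT).
- apply: filterS aeS => v Sv n _ /=; rewrite lee_fin normrX lerXn2r ?nnegrE//.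
    (* Squaring the bound requires [C] to be nonnegative, which follows from the bound itself at
       [n0]. *)
    by rewrite (le_trans (normr_ge0 _) (hC n0 _ _ Sv))//=.
  by apply: hC => //=; rewrite leq_addl.
- by rewrite integral0.
Qed.

(** By stationarity, applied to a cylinder on coordinate [n], the events that [Y n] and [Y n.+1]
    leave [A] have equal probability; induction does the rest. *)
Lemma ae_stationary (A : set R) : measurable A ->
  {ae P, forall w, A (Y 0%N w)} -> {ae P, forall w, forall n, A (Y n w)}.
Proof.
move=> mA h; apply: ae_foralln => n; elim: n => [//|n IH].
have mAY i : measurable (Y i @^-1` (~` A)).
  by rewrite -[X in measurable X]setTI; apply: mY => //; exact: measurableC.
exists (Y n.+1 @^-1` (~` A)); split => //.
have := @statP [set z | (~` A) (z n).2].
rewrite /preimage/= => <-; last first.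
  by apply: sub_sigma_algebra; exists n; right; exists (~` A); split => //; exact: measurableC.
have [B [mB PB hB]] := IH.
exact: (subset_measure0 (mAY n) mB _ PB).
Qed.

(** The estimate is an average with nonnegative weights, or 0 by the convention [0 / 0 = 0] when all
    weights vanish; the latter case relies on [0 <= D]. *)
Lemma norm_Mhat_le (D : R) n k w x : 0 <= D -> (forall j, `|Y j w| <= D) ->
  `|Mhat K X Y n k w x| <= D.
Proof.
move=> D0 YD; rewrite /Mhat normrM normfV.
set s := \sum_(j < n) Kh K k (X j w) x.
have s0 : 0 <= s by apply: sumr_ge0 => j _; exact: K_ge0.
rewrite (ger0_norm s0); have [->|sn0] := eqVneq s 0; first by rewrite invr0 mulr0.
rewrite ler_pdivrMr ?lt0r ?sn0// /s mulr_sumr (le_trans (ler_norm_sum _ _ _))//.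
apply: ler_sum => j _; rewrite normrM [X in _ * X]ger0_norm; last exact: K_ge0.
by rewrite ler_wpM2r//; exact: K_ge0.
Qed.

Lemma norm_Mstar_le (D : R) k x : 0 <= D -> {ae P, forall w, `|Y 0%N w| <= D} ->
  S x -> `|M k x| <= D.
Proof.
move=> D0 YD Sx; have s0 := den_gt0 k Sx.
rewrite /Mstar normrM normfV ler_pdivrMr ?normr_gt0 ?gt_eqF//.
rewrite [X in D * X]ger0_norm; last exact: ltW.
have iN := integrable_phi_Kh mX mY cK K_ge0 K_le1 K0
  (@measurable_id _ _ _) iY k x.
apply: (le_trans (le_normr_Rintegral measurableT iN)).
rewrite -(RintegralZl D measurableT (integrable_Kh k x)).
apply: fine_le.
- exact: integrable_fin_num (integrable_norm iN).
- exact: integrable_fin_num (integrableZl measurableT D (integrable_Kh k x)).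
have mKh := measurable_Kh mX cK K0 k x.
apply: ae_ge0_le_integral => //.
- by apply/measurable_EFinP; apply: measurableT_comp => //; exact: measurable_funM.
- by move=> w _; rewrite lee_fin mulr_ge0//; exact: K_ge0.
- by apply/measurable_EFinP; apply: measurable_funM => //; exact: measurable_cst.
apply: filterS YD => w YwD _ /=; rewrite lee_fin normrM [X in _ * X]ger0_norm; last exact: K_ge0.
by rewrite ler_wpM2r//; exact: K_ge0.
Qed.

Lemma norm_mhat_sub_mstar_le (D : R) n w x : 0 <= D -> (forall j, `|Y j w| <= D) ->
  {ae P, forall w, `|Y 0%N w| <= D} -> S x ->
  `|mh n w x - m x| <= (D + L) + (D + L).
Proof.
move=> D0 YD aeYD Sx; rewrite (le_trans (ler_normB _ _))// lerD//.
  rewrite (le_trans (ler_normD _ _))// lerD//; first exact: norm_Mhat_le.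
  exact: (norm_trunc_sum L0 (fun k => Mhat K X Y n k w x)).
rewrite (le_trans (ler_normD _ _))// lerD//; first exact: norm_Mstar_le.
exact: (norm_lim_trunc_sum L0 (M ^~ x)).
Qed.

End estimator.

(** * Pointwise, uniform and mean square convergence *)

Lemma cvg_ereal_sup_dist (R : realType) (V : Type) (S : set V)
  (f : nat -> V -> R) (g : V -> R) : S !=set0 ->
  (forall e, 0 < e -> \forall n \near \oo, forall x, S x -> `|f n x - g x| <= e) ->
  ereal_sup [set (`|f n x - g x|)%:E | x in S] @[n --> \oo] --> 0%E.
Proof.
move=> [x0 Sx0] h.
have bnd e n : (forall x, S x -> `|f n x - g x| <= e) ->
    (0 <= ereal_sup [set (`|f n x - g x|)%:E | x in S] <= e%:E)%E.
  move=> hn; apply/andP; split.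
    by apply: (@le_trans _ _ (`|f n x0 - g x0|)%:E) => //; apply: ereal_sup_ubound; exists x0.
  by apply: ge_ereal_sup => _ [x Sx <-]; rewrite lee_fin hn.
apply/fine_cvgP; split.
  have := h 1 ltr01; apply: filterS => n /bnd /andP[s0 s1].
  by rewrite ge0_fin_numE// (le_lt_trans s1)// ltry.
apply/cvgrPdist_le => e /h; apply: filterS => n /bnd /andP[s0 s1] /=.
rewrite sub0r normrN ger0_norm ?fine_ge0// -lee_fin fineK//.
by rewrite ge0_fin_numE// (le_lt_trans s1)// ltry.
Qed.

Theorem theorem2 (R : realType) (d : nat) (dT : measure_display)
  (T : measurableType dT) (P : probability T R)
  (X : nat -> T -> 'rV[R]_d) (Y : nat -> T -> R)
  (K : 'rV[R]_d -> R) (b r L : R) (N : nat -> nat) :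
  (forall i (j : 'I_d), measurable_fun setT (fun w => X i w ord0 j)) ->
  (forall i, measurable_fun setT (Y i)) ->
  stationary P X Y -> ergodic P X Y ->
  P.-integrable setT (fun w => (Y 0%N w)%:E) ->
  continuous K ->
  0 < b -> b <= 1 -> 0 < r -> r < 1 ->
  (forall x, b * (\1_(cball 0 r) x : R) <= K x) ->
  (forall x, K x <= (\1_(cball 0 1) x : R)) ->
  0 < L ->
  {homo N : m n / (m <= n)%N} ->
  (forall n, (0 < N n)%N) ->
  (forall M : nat, exists n0, forall n, (n0 <= n)%N -> (M <= N n)%N) ->
  let S := supp P (X 0%N) in
  let m := mstar K P (X 0%N) (Y 0%N) L in
  let mh := mhat K X Y N L in
  (* (a) *)
  {ae P, forall w, forall x, S x -> mh n w x @[n --> \oo] --> m x}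
  /\
  (* (b) *)
  ((exists M : R, forall x, S x -> enorm x <= M) ->
   {ae P, forall w,
     ereal_sup [set (`|mh n w x - m x|)%:E | x in S] @[n --> \oo] --> 0%E})
  /\
  (* (c) *)
  ((exists D : R, {ae P, forall w, `|Y 0%N w| <= D}) \/
   (exists M : R, forall x, S x -> enorm x <= M) ->
   {ae P, forall w,
     (\int[P]_w' ((mh n w (X 0%N w') - m (X 0%N w')) ^+ 2)%:E)%E @[n --> \oo]
       --> 0%E}).
Proof.
move=> mX mY statP ergP iY cK b0 _ r0 _ Kb K1 L0 _ _ Noo S m mh.
have K_ge0 x : 0 <= K x.
  by apply: le_trans (Kb x); rewrite mulr_ge0// ltW.
have K_le1 x : K x <= 1.
  by apply: (le_trans (K1 x)); rewrite indicE lern1 leq_b1.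
have K0 (x : 'rV[R]_d) j : 1 < `|x ord0 j| -> K x = 0.
  move=> xj; apply/le_anti; rewrite K_ge0 andbT (le_trans (K1 x))// indicE.
  rewrite memNset// /cball/= subr0; apply/negP; rewrite -ltNge.
  exact: lt_le_trans xj (coord_le_enorm _ _).
have Kb' x : cball 0 r x -> b <= K x.
  by move=> xr; have := Kb x; rewrite indicE mem_set// mulr1.
have Noo' k : \forall n \near \oo, (k <= N n)%N.
  by have [n0 hn0] := Noo k; exists n0.
have aeJ := ae_joint_consistent mX mY iY cK K_ge0 K_le1 K0
  b0 r0 Kb' L0 Noo' statP ergP.
have unif w B e : joint_consistent P X Y K L N w ->
    (forall x, S x -> enorm x <= B) -> 0 < e ->
    \forall n \near \oo, forall x, S x -> `|mh n w x - m x| <= e.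
  exact: (joint_consistent_uniform mX mY iY cK K_ge0 K_le1 K0
    b0 r0 Kb' L0).
split; [|split].
- apply: filterS aeJ => w hw x; exact: joint_consistent_pointwise.
- move=> [B SB]; apply: filterS aeJ => w hw.
  apply: cvg_ereal_sup_dist; first exact: supp_nonempty (mX 0%N).
  by move=> e; exact: unif hw SB.
- have L2 := joint_consistent_L2 mX mY iY cK K_ge0 K_le1 K0 L0.
  move=> [[D YD]|[B SB]]; last first.
    (* For bounded support, uniform convergence at precision 1 already provides the dominating
       constant. *)
    apply: filterS aeJ => w hw; apply: (L2 N _ _ hw).
    exact: unif hw SB ltr01.
  have D0 : 0 <= Num.max D 0 by rewrite le_max lexx orbT.
  have YD' : {ae P, forall w, `|Y 0%N w| <= Num.max D 0}.
    by apply: filterS YD => w h; rewrite le_max h.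
  have mA : measurable [set y : R | `|y| <= Num.max D 0].
    have := @normr_measurable R setT measurableT _ (measurable_itv `]-oo, Num.max D 0]).
    by rewrite setTI set_itvE.
  (* The estimator involves all observations, so the bound on the first response is carried over to
     every [Y n]. *)
  have YDn := ae_stationary mY statP mA YD'.
  apply: filterS2 aeJ YDn => w hw YDw; apply: (L2 N _ _ hw).
  apply: nearW => n x Sx.
  exact: (norm_mhat_sub_mstar_le N mX mY iY cK K_ge0 K_le1 K0 b0 r0 Kb' L0
    n D0 YDw YD' Sx).
Qed.
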